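(* Let $G$ be a paratopological group whose topology is regular and such that the underlying space of $G$ is $\Delta$-Baire. Then $G$ is a topological group, i.e. the inversion map $g\mapsto g^{-1}$ is continuous on $G$.
   Context: A group $G$ with a topology is called paratopological if the multiplication $G\times G\to G$ is (jointly) continuous; it is a topological group if, in addition, the inversion $g\mapsto g^{-1}$ is continuous. For a set $X$, $P\subset X\times X$ and $x\in X$ put $P_x=\{y\in X:(x,y)\in P\}$. If $X$ is a space, $P$ is called semi-open if every $P_x$ is open in $X$; $P$ is a semi-neighborhood of the diagonal if $P$ is semi-open and contains the diagonal $\Delta=\{(x,x):x\in X\}$. A regular space $X$ is called $\Delta$-Baire if for every semi-neighborhood of the diagonal $P\subset X\times X$ there is a nonempty open set $W\subset X$ with $W\times W\subset\overline P$ (closure in $X\times X$). *)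

(* Defs.v *)
From HB Require Import structures.
From mathcomp Require Import all_boot.
From mathcomp Require Import all_classical topology.

Set Implicit Arguments.
Unset Strict Implicit.
Unset Printing Implicit Defensive.

Local Open Scope classical_set_scope.
Local Open Scope group_scope.

(* A group together with a topology, with no compatibility requirement
   (multiplicative analogue of PreTopologicalZmodule). *)
#[short(type="preTopologicalGroupType")]
HB.structure Definition PreTopologicalGroup := {G of Topological G & Group G}.

(* G * G carries the product topology, so this is joint continuity. *)
Definition paratopological_group (G : preTopologicalGroupType) : Prop :=
  continuous (fun z : G * G => z.1 * z.2).

Definition topological_group (G : preTopologicalGroupType) : Prop :=
  paratopological_group G /\ continuous (fun g : G => g^-1).

Definition semi_open (X : topologicalType) (P : set (X * X)) : Prop :=
  forall x : X, open (xsection P x).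

Definition semi_nbhs_diagonal (X : topologicalType) (P : set (X * X)) : Prop :=
  semi_open P /\ diagonal `<=` P.

(* Only the Baire-type condition: the notion is meant for regular spaces, and
   regular_space X is to be assumed separately. *)
Definition delta_Baire (X : topologicalType) : Prop :=
  forall P : set (X * X), semi_nbhs_diagonal P ->
    exists W : set X, [/\ open W, W !=set0 & W `*` W `<=` closure P].

(* Main.v *)
Require Import Defs.
From mathcomp Require Import all_boot.
From mathcomp Require Import all_classical topology.

(** Fix a closed neighborhood [C] of [1] and an open [U] containing [1] with
    [U * U] inside [C].  The relation [y \in x U], i.e. [x^-1 * y \in U], is a
    left-invariant semi-neighborhood of the diagonal, so its closure contains
    some [W `*` W] with [W] open and nonempty, and left invariance lets us move
    a point of [W] to [1].  Each [x] of this translate then satisfies: [(x, 1)]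
    is a limit of pairs [(x v, x n)] with [v \in U], [x n \in x v U] and [n]
    close to [x^-1]; hence [n \in U * U], and [x^-1] lies in the closed set [C]
    ([delta_Baire_invg_near1]).  Closed neighborhoods form a base at [1] by
    regularity, so inversion is continuous at [1], and translations carry this
    to every point ([invg_continuous_from1]). *)

Local Open Scope classical_set_scope.
Local Open Scope group_scope.

Lemma mulgl_continuous (G : preTopologicalGroupType) (a : G) :
  paratopological_group G -> continuous (fun x : G => a * x).
Proof.
move=> Gmul x.
exact: (cvg_comp _ _ (cvg_pair (cvg_cst a) cvg_id) (Gmul (a, x))).
Qed.

Lemma mulgr_continuous (G : preTopologicalGroupType) (a : G) :
  paratopological_group G -> continuous (fun x : G => x * a).
Proof.
move=> Gmul x.
exact: (cvg_comp _ _ (cvg_pair cvg_id (cvg_cst a)) (Gmul (x, a))).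
Qed.

Lemma nbhs_ltranslate (G : preTopologicalGroupType) (a x : G) (A : set G) :
  paratopological_group G -> nbhs x A -> nbhs (a * x) [set z | A (a^-1 * z)].
Proof.
by move=> Gmul xA; apply: (mulgl_continuous G a^-1 Gmul); rewrite mulKg.
Qed.

Lemma nbhs1_mul (G : preTopologicalGroupType) (A : set G) :
  paratopological_group G -> nbhs (1 : G) A ->
  exists U : set G, [/\ open U, U 1 & forall u v, U u -> U v -> A (u * v)].
Proof.
move=> Gmul A1; have /= := Gmul (1, 1) A; rewrite mulg1 => /(_ A1).
move=> [[U V] /= [U1 V1] UVA].
exists (U `&` V)^°; split; first exact: open_interior.
- exact: filterI.
- move=> u v /interior_subset [Uu _] /interior_subset [_ Vv].
  exact: (UVA (u, v)).
Qed.

(** Left invariance of the relation and homogeneity replace the open square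
    given by the Baire condition with one around [(1, 1)]; the point [n] below
    is an approximation of [x^-1] lying in [U * U]. *)
Lemma delta_Baire_invg_near1 (G : preTopologicalGroupType) (C : set G) :
  paratopological_group G -> delta_Baire G ->
  nbhs (1 : G) C -> closed C -> nbhs (1 : G) [set x | C x^-1].
Proof.
move=> Gmul Gbaire C1 Cclosed.
have [U [Uopen U1 UUC]] := nbhs1_mul _ _ Gmul C1.
pose P : set (G * G) := [set p | U (p.1^-1 * p.2)].
have [|W [Wopen [w Ww] WP]] := Gbaire P.
  split=> [x|[x y]]; last by rewrite /diagonal /P /= => ->; rewrite mulVg.
  have -> : xsection P x = (fun y => x^-1 * y) @^-1` U.
    by apply/seteqP; split=> y; rewrite /xsection /= inE.
  by apply: open_comp Uopen => y _; exact: mulgl_continuous.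
have W1 : nbhs (1 : G) [set x | W (w * x)].
  apply: (mulgl_continuous G w Gmul); rewrite mulg1.
  exact: open_nbhs_nbhs.
apply: filterS W1 => x /= Wwx; apply: contrapT => nCx.
have nC : nbhs x^-1 (~` C).
  by apply: open_nbhs_nbhs; split=> //; exact: closed_openC.
have wxU := nbhs_ltranslate G (w * x) _ _ Gmul (open_nbhs_nbhs (conj Uopen U1)).
have wxN := nbhs_ltranslate G (w * x) _ _ Gmul nC.
rewrite mulg1 in wxU; rewrite mulgK in wxN.
have [[y z] [/= Pyz [/= Uy]]] := WP (w * x, w) (conj Wwx Ww) _
  (ex_intro2 _ _ (_, _) (conj wxU wxN) (fun _ => id)).
(* With y = w x v and z = w x n, we have y^-1 z = v^-1 n and n = v (v^-1 n). *)
by apply; have := UUC _ _ Uy Pyz; rewrite mulgA mulgK.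
Qed.

Lemma invg_continuous_from1 (G : preTopologicalGroupType) :
  paratopological_group G ->
  (forall A : set G, nbhs (1 : G) A -> nbhs (1 : G) [set x | A x^-1]) ->
  continuous (fun g : G => g^-1).
Proof.
move=> Gmul inv1 g A gA.
have /inv1 A1 : nbhs (1 : G) [set x | A (x * g^-1)].
  by apply: (mulgr_continuous G g^-1 Gmul); rewrite mul1g.
have := nbhs_ltranslate G g _ _ Gmul A1; rewrite mulg1.
by apply: filterS => z /=; rewrite invgM invgK mulgK.
Qed.

Theorem mainTheorem1 (G : preTopologicalGroupType) :
  paratopological_group G ->
  regular_space G ->
  delta_Baire G ->
  topological_group G.
Proof.
move=> Gmul Greg Gbaire; split=> //.
apply: invg_continuous_from1 => // A /Greg[B B1 BA].
have cB1 : nbhs (1 : G) (closure B) by apply: filterS B1; exact: subset_closure.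
have := delta_Baire_invg_near1 _ _ Gmul Gbaire cB1 (@closed_closure _ B).
by apply: filterS => x /BA.
Qed.
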